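(* Suppose that $\mathbf y$ is a complex sequence satisfying $\mathbf M^{\mathbb C}_s(\mathbf y)\succeq 0$ and $\operatorname{rank}\mathbf M^{\mathbb C}_s(\mathbf y)=\operatorname{rank}\mathbf M^{\mathbb C}_{s+1}(\mathbf y)$. Then for any $i\in\{1,\ldots,n\}$, the multiplication operator $M_i$ is normal if and only if $\mathbf N^i_s(\mathbf y)\succeq 0$.
   Context: Let $n\ge1$, $s\in\mathbb N$, and let $\mathbf z=(z_1,\ldots,z_n)$ be complex variables. For $\alpha\in\mathbb N^n$ let $|\alpha|=\sum_i\alpha_i$. $\mathbb C[\mathbf z]_r$ is the space of holomorphic polynomials in $\mathbf z$ of degree at most $r$, and $[\mathbf z]_r$ is the column vector of monomials $\mathbf z^{\beta}$, $|\beta|\le r$. A complex sequence means $\mathbf y=(y_{\beta,\gamma})_{\beta,\gamma\in\mathbb N^n}\subset\mathbb C$ with $y_{\beta,\gamma}=\overline{y_{\gamma,\beta}}$ for all $\beta,\gamma$. It defines the linear functional $L_{\mathbf y}:\mathbb C[\mathbf z,\bar{\mathbf z}]\to\mathbb C$, $L_{\mathbf y}(\sum p_{\beta,\gamma}\mathbf z^\beta\bar{\mathbf z}^\gamma)=\sum p_{\beta,\gamma}y_{\beta,\gamma}$. For $g\in\mathbb C[\mathbf z,\bar{\mathbf z}]$ put $\mathbf M^{\mathbb C}_r(g\mathbf y)=L_{\mathbf y}([\mathbf z]_r[\mathbf z]_r^*\,g)$ (entrywise) and $\mathbf M^{\mathbb C}_r(\mathbf y)=\mathbf M^{\mathbb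 C}_r(1\cdot\mathbf y)$. $A\succeq0$ means that $A$ is Hermitian positive semidefinite. Define $$\mathbf N^i_s(\mathbf y)=\begin{bmatrix}\mathbf M^{\mathbb C}_s(\mathbf y)&\mathbf M^{\mathbb C}_s(z_i\mathbf y)\\ \mathbf M^{\mathbb C}_s(\bar z_i\mathbf y)&\mathbf M^{\mathbb C}_s(|z_i|^2\mathbf y)\end{bmatrix}.$$ Let $\langle p,q\rangle_{\mathbf y}=L_{\mathbf y}(p\bar q)$ be the sesquilinear form associated with $\mathbf y$, and $\ker\mathbf M^{\mathbb C}_r(\mathbf y)=\{p\in\mathbb C[\mathbf z]_r: \langle p,q\rangle_{\mathbf y}=0\ \forall q\in\mathbb C[\mathbf z]_r\}$. Under the hypotheses on $\mathbf y$, $\mathbb C[\mathbf z]_s/\ker\mathbf M^{\mathbb C}_s(\mathbf y)\cong\mathbb C[\mathbf z]_{s+1}/\ker\mathbf M^{\mathbb C}_{s+1}(\mathbf y)$ (via the inclusion $\mathbb C[\mathbf z]_s\subset\mathbb C[\mathbf z]_{s+1}$). For $i\in\{1,\ldots,n\}$ the multiplication operator $M_i$ is defined by $$M_i:\mathbb C[\mathbf z]_s/\ker\mathbf M^{\mathbb C}_s(\mathbf y)\to\mathbb C[\mathbf z]_{s+1}/\ker\mathbf M^{\mathbb C}_{s+1}(\mathbf y),\quad p\mapsto z_ip,$$ and is regarded, via the isomorphism, as an operator on this finite-dimensional space with the inner product induced by $\langle\cdot,\cdot\rangle_{\mathbf y}$. A linear operator $T$ is normal if $T^*T-TT^*=0$,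 where $T^*$ denotes the adjoint of $T$. *)

(* Defs.v *)
From HB Require Import structures.
From mathcomp Require Import all_boot all_order all_algebra.
From mathcomp Require Import boolp reals complex ssrcomplements mpoly.

Set Implicit Arguments.
Unset Strict Implicit.
Unset Printing Implicit Defensive.

Import Order.TTheory GRing.Theory Num.Theory.

Local Open Scope ring_scope.
Local Open Scope sesquilinear_scope.
Local Open Scope quotient_scope.

(* The library only gives {quot K} a zmodType structure; [lquot K_scale]
   is the same quotient, for K a submodule, with its module structure. *)
Section ModuleQuotient.
Variables (R : nzRingType) (V : lmodType R) (K : zmodClosed V).
Hypothesis K_scale : GRing.scaler_closed K.

Definition lquot of GRing.scaler_closed K := Quotient.quot K.
Local Notation Q := (lquot K_scale).

HB.instance Definition _ := GRing.Zmodule.on Q.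
HB.instance Definition _ : EqQuotient V (Quotient.equiv K) Q :=
  EqQuotient.on Q.

Lemma lquotP (u v : V) : (\pi_Q u = \pi_Q v) <-> (u - v \in K).
Proof. by rewrite (Quotient.idealrBE K); split=> [->//|/eqP]. Qed.

Lemma lquot_piD (u v : V) : \pi_Q (u + v) = \pi_Q u + \pi_Q v.
Proof. exact: (raddfD \pi_(Quotient.quot K)). Qed.

Definition lquot_scale (a : R) (x : Q) : Q := \pi_Q (a *: repr x).

Lemma lquot_piZ a (u : V) : \pi_Q (a *: u) = lquot_scale a (\pi_Q u).
Proof.
apply: (proj2 (lquotP _ _)); rewrite -scalerBr; apply: K_scale.
by apply: (proj1 (lquotP _ _)); rewrite reprK.
Qed.

Fact lquot_scaleA a b x :
  lquot_scale a (lquot_scale b x) = lquot_scale (a * b) x.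
Proof. by rewrite -[x]reprK -(lquot_piZ b) -!lquot_piZ scalerA. Qed.

Fact lquot_scale1 : left_id 1 lquot_scale.
Proof. by move=> x; rewrite -[x]reprK -lquot_piZ scale1r. Qed.

Fact lquot_scaleDr : right_distributive lquot_scale +%R.
Proof.
move=> a x y; rewrite -[x]reprK -[y]reprK.
by rewrite -lquot_piD -!lquot_piZ scalerDr lquot_piD.
Qed.

Fact lquot_scaleDl x : {morph lquot_scale^~ x : a b / a + b}.
Proof. by move=> a b; rewrite -[x]reprK -!lquot_piZ scalerDl lquot_piD. Qed.

HB.instance Definition _ := GRing.Zmodule_isLmodule.Build R Q
  lquot_scaleA lquot_scale1 lquot_scaleDr lquot_scaleDl.

End ModuleQuotient.

Section Polynomials.
Variables (C : numClosedFieldType) (n : nat).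

(* C[z, zbar] is {mpoly C[n + n]}: z_i is the i-th variable of the left block,
   zbar_i the i-th variable of the right block. *)
Definition zvar (i : 'I_n) : {mpoly C[n + n]} := 'X_(lshift n i).
Definition zbar (i : 'I_n) : {mpoly C[n + n]} := 'X_(rshift n i).

Definition holo (p : {mpoly C[n]}) : {mpoly C[n + n]} :=
  p \mPo [tuple zvar i | i < n].

Definition conjp (P : {mpoly C[n + n]}) : {mpoly C[n + n]} :=
  map_mpoly Num.conj P \mPo
    [tuple match split j with inl i => zbar i | inr i => zvar i end
      | j < n + n].

(* msize is one more than the total degree. *)
Definition deg_le (r : nat) : pred {mpoly C[n]} :=
  fun p => (msize p <= r.+1)%N.

Fact deg_le_submod r : submod_closed (deg_le r).
Proof.
split=> [|a p q]; rewrite !unfold_in /=; first by rewrite msize0.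
move=> hp hq; apply: leq_trans (msizeD_le _ _) _.
by rewrite geq_max hq (leq_trans (msizeZ_le _ _) hp).
Qed.

HB.instance Definition _ r :=
  GRing.isSubmodClosed.Build C {mpoly C[n]} (deg_le r) (GRing.submod_closed_semi (deg_le_submod r)).

Record cpoly (r : nat) :=
  CPoly { cpoly_val :> {mpoly C[n]}; _ : cpoly_val \in deg_le r }.

HB.instance Definition _ r := [isSub for @cpoly_val r].
HB.instance Definition _ r := [Choice of cpoly r by <:].
HB.instance Definition _ r := [SubChoice_isSubLmodule of cpoly r by <:].

Fact cpoly_incl_subproof r (p : cpoly r) : (p : {mpoly C[n]}) \in deg_le r.+1.
Proof. by case: p => p /= /leq_trans; apply. Qed.

Definition cpoly_incl r (p : cpoly r) : cpoly r.+1 :=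
  CPoly (cpoly_incl_subproof p).

Fact cpoly_mulz_subproof (i : 'I_n) r (p : cpoly r) :
  'X_i * (p : {mpoly C[n]}) \in deg_le r.+1.
Proof.
case: p => p /=; rewrite !unfold_in => hp.
have [->|p_neq0] := eqVneq p 0; first by rewrite mulr0 msize0.
by rewrite msizeM -?msize_poly_eq0 ?msizeX ?mdeg1 ?msize_poly_eq0 ?add2n.
Qed.

Definition cpoly_mulz (i : 'I_n) r (p : cpoly r) : cpoly r.+1 :=
  CPoly (cpoly_mulz_subproof i p).

End Polynomials.

Section Moments.
Variables (C : numClosedFieldType) (n : nat).
Variable y : 'X_{1..n} -> 'X_{1..n} -> C.

Definition complex_sequence := forall b c, y b c = (y c b)^*.

Definition riesz (P : {mpoly C[n + n]}) : C :=
  \sum_(m <- msupp P)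
    P@_m * y [multinom m (lshift n i) | i < n] [multinom m (rshift n i) | i < n].

(* The index set of [z]_r, all monomials of degree at most r. *)
Local Notation mon r := 'X_{1..n < r.+1}.

Definition zvec (r : nat) : 'cV[{mpoly C[n + n]}]_#|{: mon r}| :=
  \col_a holo 'X_[(enum_val a : mon r)].

Definition moment_mx (r : nat) (g : {mpoly C[n + n]}) : 'M[C]_#|{: mon r}| :=
  map_mx (fun P => riesz (P * g)) (zvec r *m (map_mx (@conjp C n) (zvec r))^T).

Definition psdmx m (A : 'M[C]_m) : Prop :=
  A \is hermsymmx /\ forall v : 'cV[C]_m, 0 <= (v^t* *m A *m v) 0 0.

Definition Nmx (s : nat) (i : 'I_n) : 'M[C]_(#|{: mon s}| + #|{: mon s}|) :=
  block_mx (moment_mx s 1)              (moment_mx s (zvar C i))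
           (moment_mx s (zbar C i))     (moment_mx s (zvar C i * zbar C i)).

Definition yform (p q : {mpoly C[n]}) : C := riesz (holo p * conjp (holo q)).

Fact rieszE k P : (msize P <= k)%N ->
  riesz P = \sum_(m : 'X_{1..(n + n) < k})
    P@_m * y [multinom (m : 'X_{1..(n + n)}) (lshift n i) | i < n]
             [multinom (m : 'X_{1..(n + n)}) (rshift n i) | i < n].
Proof.
move=> le_Pk; rewrite /riesz (big_mksub 'X_{1..(n + n) < k}) ?msupp_uniq //=.
  by rewrite big_rmcond //= => j /memN_msupp_eq0 ->; rewrite mul0r.
by move=> x /msize_mdeg_lt /leq_trans; apply.
Qed.

Fact riesz_is_linear : scalar riesz.
Proof.
move=> a P Q; set k := maxn (msize (a *: P + Q)) (maxn (msize P) (msize Q)).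
rewrite !(@rieszE k) ?leq_max ?leqnn ?orbT // mulr_sumr -big_split /=.
by apply: eq_bigr => m _; rewrite mcoeffD mcoeffZ mulrDl mulrA.
Qed.

HB.instance Definition _ :=
  GRing.isLinear.Build C {mpoly C[n + n]} C *%R riesz riesz_is_linear.

Fact yform_linearl q : scalar (yform^~ q).
Proof.
by move=> a p p'; rewrite /yform /holo linearP mulrDl -scalerAl linearP.
Qed.

Definition kerM (r : nat) : pred (cpoly C n r) :=
  fun p => `[< forall q : cpoly C n r, yform p q = 0 >].

Fact kerM_submod r : submod_closed (@kerM r).
Proof.
split=> [|a p p']; rewrite !unfold_in /=.
  by apply/asboolP=> q; have := yform_linearl q (-1) 0 0;
     rewrite scaler0 addr0 mulN1r addNr.
move=> /asboolP hp /asboolP hp'; apply/asboolP => q.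
by rewrite yform_linearl hp hp' mulr0 addr0.
Qed.

HB.instance Definition _ r :=
  GRing.isSubmodClosed.Build C (cpoly C n r) (@kerM r) (GRing.submod_closed_semi (@kerM_submod r)).

Fact kerM_scale r : GRing.scaler_closed (@kerM r).
Proof.
exact: GRing.subsemimod_closedZ (GRing.submod_closed_semi (@kerM_submod r)).
Qed.

Definition cquot (r : nat) := lquot (@kerM_scale r).

HB.instance Definition _ r := GRing.Lmodule.on (cquot r).
HB.instance Definition _ r := EqQuotient.on (cquot r).

Definition qclass r (p : cpoly C n r) : cquot r := \pi_(cquot r) p.

(* Inner product on the quotient: independent of the representatives as soon as
   [complex_sequence] holds, which makes the left kernel [kerM] also the right
   one. *)
Definition qform r (u v : cquot r) : C := yform (repr u) (repr v).

Definition is_adjoint r (T T' : {linear cquot r -> cquot r}) : Prop :=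
  forall u v, qform (T u) v = qform u (T' v).

Definition is_normal r (T : {linear cquot r -> cquot r}) : Prop :=
  exists2 T' : {linear cquot r -> cquot r},
    is_adjoint T T' & forall u, T' (T u) - T (T' u) = 0.

(* T is J^-1 \o M, where J is the isomorphism induced by the inclusion and M is
   p |-> z_i p.  J and M are prescribed on every representative p, so their
   existence includes the fact that they do not depend on it. *)
Definition is_mulop s (i : 'I_n) (T : {linear cquot s -> cquot s}) : Prop :=
  exists J M : {linear cquot s -> cquot s.+1},
    [/\ bijective J,
        forall p : cpoly C n s, J (qclass p) = qclass (cpoly_incl p),
        forall p : cpoly C n s, M (qclass p) = qclass (cpoly_mulz i p)
      & forall u, J (T u) = M u].

Definition mulop_normal s (i : 'I_n) : Prop :=
  exists2 T : {linear cquot s -> cquot s}, is_mulop i T & is_normal T.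

End Moments.

(* Main.v *)
From HB Require Import structures.
Require Import Defs.
From mathcomp Require Import all_boot all_order all_algebra.
From mathcomp Require Import boolp reals complex mpoly.

(** Writing T for M_i, the quadratic form of N_s^i at a pair (p, q) is
<p, p> + <T p, q> + <q, T p> + <T q, T q> = |p + T^* q|^2 + |T q|^2 - |T^* q|^2.
If T is normal the last two terms cancel, so the form is nonnegative; conversely,
taking p = - T^* q shows that T is hyponormal, and in finite dimension a hyponormal
operator is normal because T^* T - T T^* is positive with zero trace.  That T is well
defined is not automatic: in the converse direction it is deduced from N_s^i >= 0,
which forces z_i p to be orthogonal to all q of degree at most s whenever p is in the
kernel of M_s; flatness extends this to all q of degree at most s + 1. *)

Set Implicit Arguments.
Unset Strict Implicit.
Unset Printing Implicit Defensive.

Import Order.TTheory GRing.Theory Num.Theory.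

Local Open Scope ring_scope.
Local Open Scope sesquilinear_scope.
Local Open Scope quotient_scope.

(** * Positive semidefinite matrices, written with row vectors *)

Section PositiveMatrices.
Variable C : numClosedFieldType.

Lemma sesqui_mxext m1 m2 (A B : 'M[C]_(m1, m2)) :
  (forall (v : 'rV_m1) (w : 'rV_m2), v *m A *m w^t* = v *m B *m w^t*) -> A = B.
Proof.
move=> eqAB; apply/matrixP=> i j.
have /matrixP/(_ 0 0) := eqAB (delta_mx 0 i) (delta_mx 0 j).
by rewrite trmx_delta map_delta_mx -!rowE -!colE !mxE.
Qed.

Lemma adjmxM m1 m2 m3 (A : 'M[C]_(m1, m2)) (B : 'M[C]_(m2, m3)) :
  (A *m B)^t* = B^t* *m A^t*.
Proof. by rewrite trmx_mul map_mxM. Qed.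

Lemma psdmxP m (A : 'M[C]_m) :
  psdmx A <-> A^t* = A /\ forall v : 'rV[C]_m, 0 <= (v *m A *m v^t*) 0 0.
Proof.
split=> [] [hA pA]; split.
- by have /is_hermitianmxP := hA; rewrite expr0 scale1r.
- by move=> v; have := pA (v^t*); rewrite trmxCK.
- by apply/is_hermitianmxP; rewrite expr0 scale1r hA.
- by move=> v; have := pA (v^t*); rewrite trmxCK.
Qed.

Lemma row_norm_eq0 m (x : 'rV[C]_m) : (x *m x^t*) 0 0 = 0 -> x = 0.
Proof.
rewrite mxE => /psumr_eq0P x0; apply/rowP => j; apply/eqP.
rewrite mxE -mul_conjC_eq0; apply/eqP.
have := x0 _ j isT; rewrite !mxE; apply.
by move=> k _; rewrite !mxE mul_conjC_ge0.
Qed.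

Lemma block_mx_form m1 m2 (A : 'M[C]_m1) B D (E : 'M[C]_m2)
    (v : 'rV_m1) (w : 'rV_m2) :
  (row_mx v w *m block_mx A B D E *m (row_mx v w)^t*) 0 0 =
  (v *m A *m v^t*) 0 0 + (v *m B *m w^t*) 0 0 + (w *m D *m v^t*) 0 0
  + (w *m E *m w^t*) 0 0 :> C.
Proof.
rewrite tr_row_mx map_col_mx mul_row_block mul_row_col !mulmxDl 3!mxE.
by rewrite [X in _ + X = _]mxE !addrA; congr (_ + _); rewrite addrAC.
Qed.

(* F is a square root of A up to a unitary, and G its pseudo-inverse. *)
Lemma psdmx_factor m (A : 'M[C]_m) : psdmx A ->
  exists F G : 'M[C]_m,
    [/\ F *m F^t* = A, F *m G *m A = A & (G *m F)^t* = G *m F].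
Proof.
move=> psdA; have /psdmxP[hA pA] := psdA.
have /hermitian_normalmx/orthomx_spectralP := psdA.1.
set U := spectralmx A; set d := spectral_diag A => defA.
have Uu : U \is unitarymx by exact: spectral_unitarymx.
have UU : U *m U^t* = 1%:M by apply/unitarymxP.
rewrite invmx_unitary // in defA.
have defd : U *m A *m U^t* = diag_mx d.
  by rewrite {1}defA !mulmxA UU mul1mx -mulmxA UU mulmx1.
have d_ge0 i : 0 <= d 0 i.
  have := pA (row i U); rewrite -row_mul.
  have -> : (row i (U *m A) *m ((row i U)^t*)) 0 0 = (U *m A *m U^t*) i i.
    by rewrite !mxE; apply: eq_bigr => k _; rewrite !mxE.
  by rewrite defd mxE eqxx mulr1n.
(* As [0^-1 = 0], the row [e] vanishes at the zero eigenvalues, so [e * r] is the indicator of the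
   nonzero ones. *)
pose r := map_mx sqrtC d; pose e : 'rV[C]_m := map_mx (fun x => (sqrtC x)^-1) d.
have rC : (diag_mx r)^t* = diag_mx r.
  rewrite tr_diag_mx map_diag_mx; congr diag_mx; apply/rowP => i.
  by rewrite !mxE /= conj_Creal // ger0_real // sqrtC_ge0.
have eC : (diag_mx e)^t* = diag_mx e.
  rewrite tr_diag_mx map_diag_mx; congr diag_mx; apply/rowP => i.
  by rewrite !mxE /= conj_Creal // ger0_real // invr_ge0 sqrtC_ge0.
have defGF : diag_mx e *m U *m (U^t* *m diag_mx r) = diag_mx e *m diag_mx r.
  by rewrite mulmxA -(mulmxA (diag_mx e)) UU mulmx1.
exists (U^t* *m diag_mx r), (diag_mx e *m U); split.
- rewrite adjmxM trmxCK rC mulmxA -(mulmxA (U^t*)) [RHS]defA.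
  congr (_ *m _ *m _); rewrite mulmx_diag; congr diag_mx; apply/rowP => i.
  by rewrite !mxE -expr2 sqrtCK.
- rewrite [in LHS]defA !mulmxA.
  rewrite -(mulmxA _ U) UU mulmx1 [RHS]defA; congr (_ *m _).
  rewrite -!mulmxA; congr (_ *m _); rewrite !mulmx_diag; congr diag_mx.
  apply/rowP => i; rewrite !mxE; have [->|nz] := eqVneq (d 0 i) 0.
    by rewrite !mulr0.
  by rewrite mulrA mulfV ?mul1r // sqrtC_eq0.
- by rewrite defGF adjmxM rC eC !mulmx_diag; congr diag_mx;
     apply/rowP => i; rewrite !mxE mulrC.
Qed.

(** If A = F F^*, the trace is the sum of all |F i j|^2, so F vanishes with it. *)
Lemma psdmx_tr_eq0 m (A : 'M[C]_m) : psdmx A -> \tr A = 0 -> A = 0.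
Proof.
move=> /psdmx_factor[F [_ [<- _ _]]] trF; suff -> : F = 0 by rewrite mul0mx.
have sum_ge0 i : 0 <= \sum_j F i j * (F i j)^*.
  by apply: sumr_ge0 => j _; rewrite mul_conjC_ge0.
have {}trF : \sum_i \sum_j F i j * (F i j)^* = 0.
  rewrite -[RHS]trF; apply: eq_bigr => i _.
  by rewrite !mxE; apply: eq_bigr => j _; rewrite !mxE.
apply/matrixP => i j; rewrite mxE; apply/eqP; rewrite -mul_conjC_eq0.
have /psumr_eq0P rowF : \sum_j F i j * (F i j)^* = 0.
  by apply: (psumr_eq0P _ trF).
by rewrite rowF // => k _; rewrite mul_conjC_ge0.
Qed.

End PositiveMatrices.

(** * Adjoints and hyponormal operators in finite dimension *)

Section FiniteDimensionalOperators.
Variables (C : numClosedFieldType) (V : lmodType C) (N : nat).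
(* An isometric copy of V inside 'rV_N: phi embeds V, and phi \o psi is the
   orthogonal projection onto its image. *)
Variables (phi : {linear V -> 'rV[C]_N}) (psi : {linear 'rV[C]_N -> V}).
Hypothesis phiK : cancel phi psi.
Hypothesis phi_psi_adj : forall x y,
  phi (psi x) *m y^t* = x *m (phi (psi y))^t*.

Let adjoint_of (T T' : V -> V) := forall u v,
  phi (T u) *m (phi v)^t* = phi u *m (phi (T' v))^t*.

Let opmx (T : {linear V -> V}) : 'M[C]_N := lin1_mx (phi \o T \o psi).

Let mul_opmx T x : x *m opmx T = phi (T (psi x)).
Proof. by rewrite /opmx mul_rV_lin1. Qed.

(** The conjugate transpose of the matrix of T, carried back to V by [phi] and [psi], is the
    adjoint. *)
Lemma adjoint_exists (T : {linear V -> V}) :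
  exists T' : {linear V -> V}, adjoint_of T T'.
Proof.
exists (psi \o (mulmxr ((opmx T)^t*)) \o phi : {linear V -> V}) => u v /=.
by rewrite -phi_psi_adj phiK adjmxM trmxCK mulmxA mul_opmx phiK.
Qed.

(* Hyponormality suffices for normality since T^* T - T T^* has zero trace. *)
Lemma hyponormal_normal (T T' : {linear V -> V}) : adjoint_of T T' ->
    (forall u, (phi (T' u) *m (phi (T' u))^t*) 0 0
                 <= (phi (T u) *m (phi (T u))^t*) 0 0) ->
  forall u, T' (T u) = T (T' u).
Proof.
move=> adjT hypo u; set A := opmx T; set B := opmx T'.
(* [phi \o psi] is self-adjoint, so adjointness on V becomes conjugate transposition of matrices. *)
have adjA : A^t* = B.
  rewrite -[RHS]trmxCK; congr (_^t*); apply: sesqui_mxext => v w.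
  rewrite -(mulmxA v (B^t*)) -adjmxM !mul_opmx -[in LHS](phiK (T _)).
  by rewrite phi_psi_adj adjT phi_psi_adj phiK.
have formA v : v *m (A *m A^t* - A^t* *m A) *m v^t* =
    (v *m A) *m (v *m A)^t* - (v *m B) *m (v *m B)^t*.
  by rewrite -adjA !adjmxM trmxCK mulmxBr mulmxBl !mulmxA.
(* Rows multiply on the left, so [A *m A^t*] stands for T^* T; the difference is positive by
   hyponormality, and its trace is zero by cyclicity. *)
have /subr0_eq comAB : A *m A^t* - A^t* *m A = 0.
  apply: psdmx_tr_eq0; last by rewrite linearB /= mxtrace_mulC subrr.
  apply/psdmxP; split=> [|v].
    by rewrite linearB /= raddfB /= !adjmxM trmxCK.
  by rewrite formA !mul_opmx mxE [X in _ + X]mxE subr_ge0 hypo.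
apply: (can_inj phiK); move: comAB; rewrite adjA.
move/(congr1 (mulmx (phi u))); rewrite !mulmxA.
by rewrite !mul_opmx !phiK.
Qed.

End FiniteDimensionalOperators.

(** * Conjugation and the embedding of holomorphic polynomials *)

Section Conjugation.
Variables (C : numClosedFieldType) (n : nat).
Implicit Types P Q : {mpoly C[n + n]}.

Lemma conjpD P Q : conjp (P + Q) = conjp P + conjp Q.
Proof. by rewrite /conjp !raddfD. Qed.

Lemma conjpZ a P : conjp (a *: P) = a^* *: conjp P.
Proof. by rewrite /conjp map_mpolyZ linearZ. Qed.

Lemma conjpM P Q : conjp (P * Q) = conjp P * conjp Q.
Proof. by rewrite /conjp !rmorphM. Qed.

Lemma conjp1 : conjp (1 : {mpoly C[n + n]}) = 1.
Proof. by rewrite /conjp !rmorph1. Qed.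

Lemma conjp_zvar (i : 'I_n) : conjp (zvar C i) = zbar C i.
Proof.
rewrite /conjp /zvar map_mpolyX comp_mpolyXU -tnth_nth tnth_mktuple.
by rewrite (unsplitK (inl i)).
Qed.

Lemma holo1 : holo (1 : {mpoly C[n]}) = 1.
Proof. by rewrite /holo rmorph1. Qed.

Lemma holoM (p q : {mpoly C[n]}) : holo (p * q) = holo p * holo q.
Proof. by rewrite /holo rmorphM. Qed.

Lemma holoXU (i : 'I_n) : holo 'X_i = zvar C i.
Proof. by rewrite /holo comp_mpolyXU -tnth_nth tnth_mktuple. Qed.

Lemma holoX (a : 'X_{1..n}) : holo 'X_[a] = \prod_i zvar C i ^+ a i.
Proof.
by rewrite /holo comp_mpolyX; apply: eq_bigr => i _; rewrite tnth_mktuple.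
Qed.

Lemma conjp_holoX (a : 'X_{1..n}) :
  conjp (holo 'X_[a]) = \prod_i zbar C i ^+ a i.
Proof.
rewrite holoX (big_morph _ conjpM conjp1); apply: eq_bigr => i _.
by rewrite -conjp_zvar /conjp !rmorphXn.
Qed.

End Conjugation.

(** * The Hermitian form of the sequence *)

Section MomentForm.
Variables (C : numClosedFieldType) (n : nat).
Variable y : 'X_{1..n} -> 'X_{1..n} -> C.
Hypothesis y_seq : complex_sequence y.
Implicit Types p q : {mpoly C[n]}.

Lemma yformX a b : yform y 'X_[a] 'X_[b] = y a b.
Proof.
rewrite /yform conjp_holoX holoX.
pose c := [multinom match split j with inl i => a i | inr i => b i end | j < n + n].
have -> : \prod_i zvar C i ^+ a i * \prod_i zbar C i ^+ b i = 'X_[c].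
  rewrite mpolyXE_id big_split_ord /=; congr (_ * _).
    by apply: eq_bigr => i _; rewrite mnmE (unsplitK (inl i)).
  by apply: eq_bigr => i _; rewrite mnmE (unsplitK (inr i)).
rewrite /riesz msuppX big_seq1 mcoeffX eqxx mul1r.
congr y; apply/mnmP => i; rewrite !mnmE.
  by rewrite (unsplitK (inl i)).
by rewrite (unsplitK (inr i)).
Qed.

Lemma yformDl p p' q : yform y (p + p') q = yform y p q + yform y p' q.
Proof. by have := yform_linearl y q 1 p p'; rewrite scale1r mul1r. Qed.

Lemma yform0l q : yform y 0 q = 0.
Proof. by rewrite /yform /holo rmorph0 mul0r linear0. Qed.

Lemma yformZl a p q : yform y (a *: p) q = a * yform y p q.
Proof. by have := yform_linearl y q a p 0; rewrite !addr0 yform0l addr0. Qed.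

Lemma yformDr p q q' : yform y p (q + q') = yform y p q + yform y p q'.
Proof. by rewrite /yform /holo raddfD /= conjpD mulrDr linearD. Qed.

Lemma yformZr a p q : yform y p (a *: q) = a^* * yform y p q.
Proof. by rewrite /yform /holo linearZ /= conjpZ -scalerAr linearZ. Qed.

Lemma yform0r p : yform y p 0 = 0.
Proof. by rewrite -[0](scale0r 0) yformZr conjC0 mul0r. Qed.

(** Sesquilinearity reduces the claim to monomials, where it is the symmetry of y. *)
Lemma yformC p q : yform y p q = (yform y q p)^*.
Proof.
elim/mpolyind: p => [|c a p _ _ IHp]; first by rewrite yform0l yform0r conjC0.
rewrite yformDl yformZl yformDr yformZr IHp rmorphD rmorphM /= (conjCK c).
congr (_ * _ + _); elim/mpolyind: q {p IHp} => [|d b q _ _ IHq].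
  by rewrite yform0l yform0r conjC0.
rewrite yformDl yformZl yformDr yformZr IHq rmorphD rmorphM /=.
by congr (_ * _ + _); rewrite !yformX y_seq.
Qed.

Lemma yformBl p p' q : yform y (p - p') q = yform y p q - yform y p' q.
Proof. by rewrite -scaleN1r yformDl yformZl mulN1r. Qed.

Lemma yform_suml I r (P : pred I) F q :
  yform y (\sum_(i <- r | P i) F i) q = \sum_(i <- r | P i) yform y (F i) q.
Proof.
by apply: (big_morph (fun p => yform y p q)) => [p p'|];
   [exact: yformDl | exact: yform0l].
Qed.

Lemma yform_sumr I r (P : pred I) F p :
  yform y p (\sum_(i <- r | P i) F i) = \sum_(i <- r | P i) yform y p (F i).
Proof.
by apply: (big_morph (yform y p)) => [q q'|]; [exact: yformDr | exact: yform0r].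
Qed.

(** * Coefficient rows and Gram matrices *)

Section Coordinates.
Variable r : nat.
Local Notation N := #|{: 'X_{1..n < r.+1}}|.

Fact mon_deg_le (a : 'I_N) :
  'X_[C, (enum_val a : 'X_{1..n < r.+1})] \in deg_le r.
Proof. by rewrite unfold_in msizeX ltnS -ltnS bmdeg. Qed.

Definition mon (a : 'I_N) : cpoly C n r := CPoly (mon_deg_le a).

Definition cpoly_of (v : 'rV[C]_N) : cpoly C n r := \sum_a v 0 a *: mon a.

Definition cpoly_coef (p : cpoly C n r) : 'rV[C]_N :=
  \row_a (p : {mpoly C[n]})@_(enum_val a : 'X_{1..n < r.+1}).

Lemma cpoly_ofE v :
  (cpoly_of v : {mpoly C[n]}) =
  \sum_a v 0 a *: 'X_[(enum_val a : 'X_{1..n < r.+1})].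
Proof. by rewrite -[LHS]/(\val _) raddf_sum; apply: eq_bigr. Qed.

Lemma cpoly_coefK : cancel cpoly_coef cpoly_of.
Proof.
move=> p; apply: val_inj; rewrite [LHS]cpoly_ofE /=.
have /(mpolywE) -> : (msize (p : {mpoly C[n]}) <= r.+1)%N by case: p.
rewrite (eq_bigr (fun a => (p : {mpoly C[n]})@_(enum_val a : 'X_{1..n < r.+1})
  *: 'X_[(enum_val a : 'X_{1..n < r.+1})])) => [|a _]; last by rewrite mxE.
rewrite -(big_enum_val (fun m : 'X_{1..n < r.+1} =>
  (p : {mpoly C[n]})@_m *: 'X_[m])).
by apply: eq_bigl => m.
Qed.

Lemma cpoly_ofK : cancel cpoly_of cpoly_coef.
Proof.
move=> v; apply/rowP => b; rewrite mxE cpoly_ofE raddf_sum (bigD1 b) //=.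
rewrite mcoeffZ mcoeffX eqxx mulr1 big1 ?addr0 // => a neq_ab.
rewrite mcoeffZ mcoeffX; case: eqP => [/val_inj/enum_val_inj eq_ab|_].
  by rewrite eq_ab eqxx in neq_ab.
by rewrite mulr0.
Qed.

Fact cpoly_of_linear : linear cpoly_of.
Proof.
move=> a v w; rewrite /cpoly_of scaler_sumr -big_split; apply: eq_bigr => i _.
by rewrite !mxE scalerDl scalerA.
Qed.
HB.instance Definition _ := GRing.isLinear.Build C _ _ _ cpoly_of cpoly_of_linear.

Fact cpoly_coef_linear : linear cpoly_coef.
Proof. by move=> a p q; apply/rowP => i; rewrite !mxE mcoeffD mcoeffZ. Qed.
HB.instance Definition _ := GRing.isLinear.Build C _ _ _ cpoly_coef cpoly_coef_linear.

(** The moment matrix of h times the conjugate of k; with h and k among 1 and z_i it gives all four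
    blocks of N_s^i. *)
Definition gram (h k : {mpoly C[n]}) : 'M[C]_N :=
  \matrix_(a, b) yform y (h * mon a) (k * mon b).

Lemma adjmx_gram h k : (gram h k)^t* = gram k h.
Proof.
apply/matrixP => a b; rewrite /gram [RHS]mxE [RHS]yformC mxE.
by congr (_^*); rewrite 2!mxE.
Qed.

Lemma gramE (h k : {mpoly C[n]}) (v w : 'rV[C]_N) :
  (v *m gram h k *m w^t*) 0 0 =
  yform y (h * cpoly_of v) (k * cpoly_of w).
Proof.
rewrite !cpoly_ofE !mulr_sumr mxE yform_sumr; apply: eq_bigr => b _.
rewrite !mxE mulr_suml yform_suml; apply: eq_bigr => a _; rewrite mxE.
by rewrite -!scalerAr yformZl yformZr mulrCA mulrC mulrA.
Qed.

Lemma moment_mxE (h k : {mpoly C[n]}) :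
  moment_mx y r (holo h * conjp (holo k)) = gram h k.
Proof.
apply/matrixP => a b; rewrite /gram !mxE big_ord1 !mxE /yform !holoM conjpM.
by rewrite /= mulrACA (mulrC (holo 'X_[_])) [X in riesz y (_ * X) = _]mulrC.
Qed.

Lemma moment_mx1 : moment_mx y r 1 = gram 1 1.
Proof. by rewrite -moment_mxE holo1 conjp1 mulr1. Qed.

Lemma moment_mx1E (v w : 'rV[C]_N) :
  (v *m moment_mx y r 1 *m w^t*) 0 0 = yform y (cpoly_of v) (cpoly_of w).
Proof. by rewrite moment_mx1 gramE !mul1r. Qed.

End Coordinates.
End MomentForm.

(** Universal property of the quotient: f is constant on classes, so it may be evaluated at any
    representative. *)
Lemma lquot_lift (R : nzRingType) (V W : lmodType R) (K : zmodClosed V)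
    (hK : GRing.scaler_closed K) (f : {linear V -> W}) :
    (forall v, v \in K -> f v = 0) ->
  exists g : {linear lquot hK -> W}, forall v, g (\pi_(lquot hK) v) = f v.
Proof.
move=> fK; pose g (u : lquot hK) := f (repr u).
have gE v : g (\pi_(lquot hK) v) = f v.
  apply/subr0_eq; rewrite -linearB; apply: fK.
  by apply: (proj1 (lquotP hK _ _)); rewrite reprK.
have g_lin : linear g.
  move=> a u v; rewrite -[u]reprK -[v]reprK -[a *: _]lquot_piZ -lquot_piD.
  by rewrite !gE linearP.
pose glin := GRing.isLinear.Build R _ _ _ g g_lin.
pose G : {linear lquot hK -> W} := HB.pack g glin.
by exists G.
Qed.

(** * Quotients by the kernels of the moment matrices *)

Section MomentQuotients.
Variables (C : numClosedFieldType) (n : nat).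
Variable y : 'X_{1..n} -> 'X_{1..n} -> C.
Hypothesis y_seq : complex_sequence y.

Lemma block_gramE r (h k : {mpoly C[n]}) (v w : 'rV[C]_#|{: 'X_{1..n < r.+1}}|) :
  (row_mx v w *m block_mx (gram y r h h) (gram y r k h) (gram y r h k)
     (gram y r k k) *m (row_mx v w)^t*) 0 0 =
  yform y (h * cpoly_of v) (h * cpoly_of v)
  + yform y (k * cpoly_of v) (h * cpoly_of w)
  + yform y (h * cpoly_of w) (k * cpoly_of v)
  + yform y (k * cpoly_of w) (k * cpoly_of w).
Proof.
by rewrite block_mx_form; congr (_ + _ + _ + _); exact: gramE.
Qed.

(** The Hermitian symmetry of the block matrix is automatic, since the adjoint of [gram h k] is
    [gram k h]; only the sign of its form remains. *)
Lemma Nmx_psdP s i : psdmx (Nmx y s i) <->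
  forall p q : cpoly C n s,
    0 <= yform y p p + yform y ('X_i * p) q + yform y q ('X_i * p)
         + yform y ('X_i * q) ('X_i * q).
Proof.
have NE : Nmx y s i =
  block_mx (gram y s 1 1) (gram y s 'X_i 1) (gram y s 1 'X_i) (gram y s 'X_i 'X_i).
  by rewrite -!moment_mxE !holo1 !conjp1 !holoXU !conjp_zvar !mulr1 !mul1r.
rewrite psdmxP NE; split=> [[_ N_ge0] p q | N_ge0].
  have := N_ge0 (row_mx (cpoly_coef p) (cpoly_coef q)); rewrite block_gramE !cpoly_coefK.
  by rewrite (mul1r (p : {mpoly C[n]})) (mul1r (q : {mpoly C[n]})).
split=> [|v].
  by rewrite tr_block_mx map_block_mx; congr block_mx; exact: adjmx_gram.
rewrite -[v]hsubmxK block_gramE.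
rewrite (mul1r (cpoly_of (lsubmx v) : {mpoly C[n]})).
by rewrite (mul1r (cpoly_of (rsubmx v) : {mpoly C[n]})).
Qed.

Lemma kerMP r (p : cpoly C n r) :
  p \in @kerM C n y r <-> forall q : cpoly C n r, yform y p q = 0.
Proof. by rewrite unfold_in; split=> /asboolP. Qed.

Lemma qclassP r (p q : cpoly C n r) :
  qclass y p = qclass y q <->
  forall t : cpoly C n r, yform y p t = yform y q t.
Proof.
split=> [/(lquotP (@kerM_scale C n y r))/kerMP ker t | ker].
  by apply/subr0_eq; rewrite -yformBl; exact: ker.
by apply/(lquotP (@kerM_scale C n y r))/kerMP => t; rewrite yformBl ker subrr.
Qed.

Lemma qclass_linear r : linear (@qclass C n y r).
Proof.
by move=> a p q; rewrite /qclass (lquot_piD (@kerM_scale C n y r)) lquot_piZ.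
Qed.

Lemma qclassK r (u : cquot y r) : qclass y (repr u) = u.
Proof. exact: reprK. Qed.

Lemma qformE r (p q : cpoly C n r) :
  qform (qclass y p) (qclass y q) = yform y p q.
Proof.
rewrite /qform; set p' := repr (qclass y p); set q' := repr (qclass y q).
have /qclassP-> : qclass y p' = qclass y p by exact: qclassK.
rewrite (yformC y_seq); have /qclassP-> : qclass y q' = qclass y q by exact: qclassK.
by rewrite -(yformC y_seq).
Qed.

Lemma qclass_lift r (W : lmodType C) (f : {linear cpoly C n r -> W}) :
    (forall p : cpoly C n r, (forall q : cpoly C n r, yform y p q = 0) -> f p = 0) ->
  exists g : {linear cquot y r -> W}, forall p, g (qclass y p) = f p.
Proof. by move=> f0; apply: lquot_lift => p /kerMP; exact: f0. Qed.

HB.instance Definition _ r :=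
  GRing.isLinear.Build C _ _ _ (@qclass C n y r) (@qclass_linear r).

(** With M = F F^*, the map sending p to its coefficient row times F is isometric, so it kills the
    kernel and induces [phi]; [psi] comes from G. Then F G M = M gives the cancellation, and
    [phi \o psi] is multiplication by the Hermitian matrix G F. *)
Lemma cquot_coordinates r : psdmx (moment_mx y r 1) ->
  exists N, exists phi : {linear cquot y r -> 'rV[C]_N},
  exists psi : {linear 'rV[C]_N -> cquot y r},
    [/\ cancel phi psi,
        forall u v, phi (psi u) *m v^t* = u *m (phi (psi v))^t*
      & forall u v, qform u v = (phi u *m (phi v)^t*) 0 0].
Proof.
move=> psdM; have [F [G [FF FG GF]]] := psdmx_factor psdM.
have formE (p q : cpoly C n r) :
    (cpoly_coef p *m F *m (cpoly_coef q *m F)^t*) 0 0 = yform y p q.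
  rewrite adjmxM mulmxA -(mulmxA (cpoly_coef p)) FF moment_mx1E.
  by rewrite !cpoly_coefK.
have [p p0|phi phiE] := @qclass_lift r _ (mulmxr F \o @cpoly_coef C n r).
  by apply: row_norm_eq0; rewrite formE p0.
pose psi := (@qclass C n y r) \o (@cpoly_of C n r) \o mulmxr G.
exists _, phi, psi; split=> [u|u v|u v].
- rewrite -[u]qclassK phiE /=; apply/qclassP => t.
  rewrite -{1}[t]cpoly_coefK -moment_mx1E -!mulmxA.
  rewrite (mulmxA G) (mulmxA F) (mulmxA F) FG.
  by rewrite mulmxA moment_mx1E !cpoly_coefK.
- rewrite /psi /= !phiE /= !cpoly_ofK -!mulmxA.
  by rewrite adjmxM GF !mulmxA.
- by rewrite -[u]qclassK -[v]qclassK qformE !phiE /= formE.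
Qed.

Lemma cpoly_incl_linear r : linear (@cpoly_incl C n r).
Proof. by move=> a p q; apply: val_inj. Qed.
HB.instance Definition _ r :=
  GRing.isLinear.Build C _ _ _ (@cpoly_incl C n r) (@cpoly_incl_linear r).

Lemma cpoly_mulz_linear i r : linear (@cpoly_mulz C n i r).
Proof.
move=> a p q; apply: val_inj => /=.
by rewrite mulrDr scalerAr.
Qed.
HB.instance Definition _ i r :=
  GRing.isLinear.Build C _ _ _ (@cpoly_mulz C n i r) (@cpoly_mulz_linear i r).

(* With E the matrix of the inclusion, rank (E M_{s+1}) >= rank (E M_{s+1} E^* )
   = rank M_s = rank M_{s+1}, so E M_{s+1} and M_{s+1} have the same row space. *)
Lemma flat_reduce s :
    \rank (moment_mx y s 1) = \rank (moment_mx y s.+1 1) ->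
  forall q : cpoly C n s.+1, exists p : cpoly C n s,
  forall t : cpoly C n s.+1, yform y q t = yform y p t.
Proof.
move=> flat q; set M := moment_mx y s.+1 1 in flat.
pose E := lin1_mx (@cpoly_coef C n s.+1 \o @cpoly_incl C n s \o @cpoly_of C n s).
have defM : moment_mx y s 1 = E *m M *m E^t*.
  apply: sesqui_mxext => v w; apply/matrixP => i j; rewrite !ord1 moment_mx1E.
  rewrite !mulmxA -(mulmxA _ (E^t*)) -adjmxM moment_mx1E !mul_rV_lin1 /=.
  by rewrite !cpoly_coefK.
have /eqmxP EM : (E *m M == M)%MS.
  rewrite -mxrank_leqif_eq ?submxMl // eqn_leq mxrankM_maxr /=.
  by rewrite -flat defM mxrankM_maxl.
(* The row [c] lists the coefficients of a polynomial of degree at most s with the same pairings as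
   q. *)
have /submxP[c qM] : (cpoly_coef q *m M <= E *m M)%MS by rewrite EM submxMl.
exists (cpoly_of c) => t.
rewrite -[q]cpoly_coefK -[t]cpoly_coefK -moment_mx1E -/M qM !mulmxA moment_mx1E.
by rewrite mul_rV_lin1 /= !cpoly_coefK.
Qed.

End MomentQuotients.

(** * The multiplication operator and N_s^i *)

Section MultiplicationOperator.
Variables (C : numClosedFieldType) (n s : nat).
Variable y : 'X_{1..n} -> 'X_{1..n} -> C.
Hypothesis y_seq : complex_sequence y.

Lemma yform_ge0 (p : cpoly C n s) :
  psdmx (moment_mx y s 1) -> 0 <= yform y p p.
Proof.
by move=> /psdmxP[_ /(_ (cpoly_coef p))]; rewrite moment_mx1E !cpoly_coefK.
Qed.

(** A representative of T p has the same pairings as z_i p with everything of degree at most s + 1,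
    which covers both q and z_i q. *)
Lemma mulop_form i (T : {linear cquot y s -> cquot y s}) : is_mulop i T ->
  (forall p q : cpoly C n s,
     qform (T (qclass y p)) (qclass y q) = yform y ('X_i * p) q) /\
  (forall p q : cpoly C n s,
     qform (T (qclass y p)) (T (qclass y q)) = yform y ('X_i * p) ('X_i * q)).
Proof.
move=> [J [M [_ JE ME JT]]].
have TE (p : cpoly C n s) : exists2 p' : cpoly C n s, T (qclass y p) = qclass y p'
    & forall t : cpoly C n s.+1, yform y p' t = yform y ('X_i * p) t.
  exists (repr (T (qclass y p))); first by rewrite qclassK.
  apply/(qclassP y (cpoly_incl _) (cpoly_mulz i p)).
  by rewrite -JE qclassK JT ME.
split=> p q; have [p' -> p'E] := TE p.
  by rewrite (qformE y_seq); exact: (p'E (cpoly_incl q)).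
have [q' -> q'E] := TE q; rewrite (qformE y_seq) (p'E (cpoly_incl q')).
by rewrite (yformC y_seq) (q'E (cpoly_mulz i p)) -(yformC y_seq).
Qed.

Lemma mulop_normal_Nmx_psd i : psdmx (moment_mx y s 1) ->
  mulop_normal y s i -> psdmx (Nmx y s i).
Proof.
move=> y_psd [T mulT [T' adjT comT]]; apply/(Nmx_psdP y_seq) => p q.
have [T1 T2] := mulop_form mulT.
set q' := repr (T' (qclass y q)); have q'E : qclass y q' = T' (qclass y q).
  exact: qclassK.
have E1 : yform y ('X_i * p) q = yform y p q'.
  by rewrite -T1 adjT -q'E (qformE y_seq).
(* Normality enters here: |T q|^2 = <q, T^* T q> = <q, T T^* q> = |T^* q|^2. *)
have E2 : yform y ('X_i * q) ('X_i * q) = yform y q' q'.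
  rewrite -T2 adjT (subr0_eq (comT _)) -q'E.
  rewrite -[T _]qclassK (qformE y_seq) (yformC y_seq) -(qformE y_seq) qclassK.
  by rewrite adjT -q'E (qformE y_seq); exact/esym/yformC.
rewrite (yformC y_seq q) E1 -(yformC y_seq) E2.
have pq_ge0 : 0 <= yform y ((p : {mpoly C[n]}) + q') ((p : {mpoly C[n]}) + q').
  exact: (yform_ge0 (p + q') y_psd).
by rewrite yformDl 2!yformDr addrA in pq_ge0.
Qed.

(** * Consequences of flatness *)

Section Flat.
Hypothesis y_flat : \rank (moment_mx y s 1) = \rank (moment_mx y s.+1 1).

(** Flatness replaces the test polynomial t by one of degree at most s; Hermitian symmetry moves
    this replacement to the second argument. *)
Lemma flat_test (P Q : cpoly C n s.+1) :
    (forall t : cpoly C n s, yform y P t = yform y Q t) ->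
  forall t : cpoly C n s.+1, yform y P t = yform y Q t.
Proof.
move=> eqPQ t; have [t' t'E] := flat_reduce y_flat t.
have tE (S : cpoly C n s.+1) : yform y S t = yform y S t'.
  by rewrite (yformC y_seq) t'E; exact/esym/yformC.
by rewrite !tE.
Qed.

Lemma flat_incl_bij : exists2 J : {linear cquot y s -> cquot y s.+1},
  bijective J & forall p : cpoly C n s, J (qclass y p) = qclass y (cpoly_incl p).
Proof.
have [p p0|J JE] :=
    @qclass_lift C n y s _ (@qclass C n y s.+1 \o @cpoly_incl C n s).
  rewrite -[RHS](linear0 (@qclass C n y s.+1)); apply/qclassP.
  by apply: flat_test => t; rewrite yform0l p0.
exists J => //.
have Jsurj (w : cquot y s.+1) : exists u, J u = w.
  have [p pE] := flat_reduce y_flat (repr w).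
  exists (qclass y p); rewrite JE -[w]qclassK; apply/esym/qclassP => t.
  exact: pE.
(* K picks preimages under J. Injectivity of J holds because the tests of degree at most s are among
   those of degree at most s + 1. *)
have [K JK] := choice Jsurj; exists K => // u; move: (JK (J u)).
rewrite -[u]qclassK; set v := K _; rewrite -[v]qclassK !JE => /qclassP eq_uv.
by apply/qclassP => t; have := eq_uv (cpoly_incl t).
Qed.

(** * From positivity of N_s^i to the operator *)

Section Converse.
Variable i : 'I_n.
Hypothesis N_psd : forall p q : cpoly C n s,
  0 <= yform y p p + yform y ('X_i * p) q + yform y q ('X_i * p)
       + yform y ('X_i * q) ('X_i * q).

Lemma Nmx_psd_ker_mulz (p : cpoly C n s) :
    (forall t : cpoly C n s, yform y p t = 0) ->
  forall t : cpoly C n s.+1, yform y ('X_i * p) t = 0.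
Proof.
move=> p0; suff p0s (t : cpoly C n s) : yform y ('X_i * p) t = 0.
  move=> t; rewrite (@flat_test (cpoly_mulz i p) 0) ?yform0l // => u.
  by rewrite yform0l; exact: p0s.
(* At the pair (c p, t) the form is 2 Re (c w) + e, with no term in |c|^2, so a
   suitable c makes it negative unless w = 0. *)
set w := yform y _ _; set e := yform y ('X_i * t) ('X_i * t).
have e_ge0 : 0 <= e.
  have := N_psd 0 t.
  by rewrite mulr0 !yform0l yform0r !add0r.
(* This makes c w the real number -(e + 1), so the form equals -2 (e + 1) + e = -(e + 2) < 0. *)
apply/eqP/negPn/negP => w_neq0; pose c := - (e + 1) / w.
have := N_psd (c *: p) t; rewrite -/e /=.
have -> : 'X_i * (c *: (p : {mpoly C[n]})) = c *: ('X_i * p) by rewrite scalerAr.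
rewrite (yformC y_seq t) !yformZl yformZr p0 !mulr0 add0r -/w.
have -> : c * w = - (e + 1) by rewrite divfK.
have e1_gt0 : 0 < e + 1 by rewrite ltr_wpDl.
have e1_real : - (e + 1) \is Num.real by rewrite rpredN gtr0_real.
rewrite (conj_Creal e1_real) -addrA.
have -> : - (e + 1) + e = - 1 by rewrite opprD addrAC addNr add0r.
by rewrite -opprD oppr_ge0 lt_geF // addr_gt0.
Qed.

(** Multiplication by z_i descends to the quotients as M, and T is J^-1 M. *)
Lemma Nmx_psd_mulop_exists :
  exists T : {linear cquot y s -> cquot y s}, is_mulop i T.
Proof.
have [p p0|M ME] :=
    @qclass_lift C n y s _ (@qclass C n y s.+1 \o @cpoly_mulz C n i s).
  rewrite -[RHS](linear0 (@qclass C n y s.+1)); apply/qclassP => t.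
  by rewrite yform0l; apply: Nmx_psd_ker_mulz.
have [J J_bij JE] := flat_incl_bij; have [K JK KJ] := J_bij.
pose T u := K (M u).
have T_lin : linear T.
  by move=> a u v; apply: (can_inj JK); rewrite linearP /T !KJ linearP.
pose Tlin := GRing.isLinear.Build C _ _ _ T T_lin.
pose T0 : {linear cquot y s -> cquot y s} := HB.pack T Tlin.
by exists T0, J, M; split=> // u; exact: KJ.
Qed.

End Converse.

Lemma Nmx_psd_mulop_normal i : psdmx (moment_mx y s 1) ->
  psdmx (Nmx y s i) -> mulop_normal y s i.
Proof.
move=> y_psd /(Nmx_psdP y_seq) N_psd.
have [T mulT] := Nmx_psd_mulop_exists N_psd; exists T => //.
have [N [phi [psi [phiK phi_psi formE]]]] := cquot_coordinates y_seq y_psd.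
have [T' adjT'] := adjoint_exists phiK phi_psi T.
have adjT : is_adjoint T T' by move=> u v; rewrite !formE adjT'.
exists T' => // u; rewrite (hyponormal_normal phiK phi_psi adjT') ?subrr // => {}u.
have [T1 T2] := mulop_form mulT.
rewrite -!formE -[u]qclassK T2 -[T' _]qclassK (qformE y_seq).
set q := repr u; set q' := repr _.
have E1 : yform y ('X_i * q') q = yform y q' q'.
  by rewrite -T1 adjT qclassK -[T' _]qclassK (qformE y_seq).
have E2 : yform y q ('X_i * q') = yform y q' q'.
  by rewrite (yformC y_seq) E1; exact/esym/yformC.
(* With q' representing T^* q, both cross terms are -|q'|^2, so positivity at (-q', q) reads |T^*
   q|^2 <= |T q|^2. *)
have := N_psd (- q') q; rewrite /= mulrN -!scaleN1r !yformZl !yformZr E1 E2.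
by rewrite rmorphN1 !mulN1r opprK subrr add0r addrC subr_ge0.
Qed.

End Flat.
End MultiplicationOperator.

Theorem proposition3p7 (R : realType) (n s : nat) (n_gt0 : (0 < n)%N)
    (y : 'X_{1..n} -> 'X_{1..n} -> R[i]) (y_seq : complex_sequence y)
    (y_psd : psdmx (moment_mx y s 1))
    (y_flat : \rank (moment_mx y s 1) = \rank (moment_mx y s.+1 1)) :
  forall i : 'I_n, mulop_normal y s i <-> psdmx (Nmx y s i).
Proof.
move=> i; split; first exact: mulop_normal_Nmx_psd.
exact: Nmx_psd_mulop_normal.
Qed.
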